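(* Let $G$ be a finite solvable group and let $\chi \in \operatorname{Irr}(G)$ with $\chi(1)>1$. Let $\{\alpha_i \mid i=1,\ldots,n\}$ be the set of (distinct) non-principal irreducible constituents of $\chi\overline{\chi}$. If $j\in\{1,\ldots,n\}$ is such that $\operatorname{Ker}(\alpha_j)$ is maximal under inclusion among the subgroups $\operatorname{Ker}(\alpha_i)$, $i=1,\ldots,n$, of $G$, then $[\chi\overline{\chi},\alpha_j]=1$. Thus $1\in\{[\chi\overline{\chi},\alpha_i] \mid i=1,\ldots,n\}$.
   Context: $\operatorname{Irr}(G)$ is the set of irreducible complex characters of $G$, $\overline{\chi}$ is the complex conjugate of $\chi$, $[\cdot,\cdot]$ is the usual inner product of characters, and $\operatorname{Ker}(\alpha)=\{g\in G : \alpha(g)=\alpha(1)\}$. *)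

(* Defs.v *)
From mathcomp Require Import all_boot all_order all_fingroup all_algebra.
From mathcomp Require Import all_solvable all_field all_character.

Set Implicit Arguments.
Unset Strict Implicit.
Unset Printing Implicit Defensive.

Import GroupScope Order.TTheory GRing.Theory Num.Theory.
Local Open Scope ring_scope.

(* Irreducible characters are represented by their indices in Iirr G; the map *)
(* i |-> 'chi_i is injective (irr_inj) and 'chi_0 is the principal character. *)
(* Characters take values in algC, which contains all the values of complex   *)
(* characters of finite groups.                                               *)
Definition nonprincipal_constt (gT : finGroupType) (G : {group gT})
    (phi : 'CF(G)) : {set Iirr G} :=
  [set i in irr_constt phi | i != 0].

(* On irreducible characters cfker is the set of g in G with                  *)
(* 'chi_i g = 'chi_i 1: see cfkerEirr.                                        *)
Definition has_maximal_kernel (gT : finGroupType) (G : {group gT})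
    (S : {set Iirr G}) (j : Iirr G) : Prop :=
  j \in S /\
  forall i : Iirr G, i \in S ->
    cfker 'chi_j \subset cfker 'chi_i -> cfker 'chi_i = cfker 'chi_j.

(* Main.v *)
Require Import Defs.
From mathcomp Require Import all_boot all_order all_fingroup all_algebra.
From mathcomp Require Import all_solvable all_field all_character.

(** Let K be a maximal kernel, attained at alpha, and let K < L be normal in G
    with L / K abelian.  By maximality the only constituent of chi * chi^* with
    L in its kernel is the principal one, so theta := chi restricted to L is
    irreducible.  A constituent lambda of alpha restricted to L is linear, and
    [chi * chi^*, alpha] <= [theta * theta^*, lambda] = [theta, lambda * theta],
    which is at most 1 since both theta and lambda * theta are irreducible. *)

Set Implicit Arguments.
Unset Strict Implicit.
Unset Printing Implicit Defensive.

Import GroupScope Order.TTheory GRing.Theory Num.Theory.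
Local Open Scope ring_scope.

Lemma cfdot_mul_conjC (gT : finGroupType) (G : {group gT})
    (phi psi xi : 'CF(G)) : '[phi * psi^*%CF, xi] = '[phi, xi * psi].
Proof.
rewrite !cfdotE; congr (_ * _); apply: eq_bigr => x _.
by rewrite !cfunE rmorphM mulrCA mulrC mulrA.
Qed.

Lemma cfdot_mul_conjC_lin_le1 (gT : finGroupType) (G : {group gT})
    (theta lambda : 'CF(G)) :
  theta \in irr G -> lambda \is a linear_char ->
  '[theta * theta^*%CF, lambda] <= 1.
Proof.
move=> irr_theta lin_lambda; rewrite cfdot_mul_conjC.
have /irrP[j ->] := mul_lin_irr lin_lambda irr_theta.
by have /irrP[i ->] := irr_theta; rewrite cfdot_irr lern1 leq_b1.
Qed.

(** Every constituent of [phi] contributes a nonnegative term to the right-hand side, and ['chi_i]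
    alone contributes ['[phi, 'chi_i]] times a nonzero natural number. *)
Lemma cfdot_le_Res (gT : finGroupType) (G H : {group gT}) (phi : 'CF(G))
    (i : Iirr G) (j : Iirr H) :
    phi \is a character -> j \in irr_constt ('Res[H] 'chi_i) ->
  '[phi, 'chi_i] <= '['Res[H] phi, 'chi_j].
Proof.
move=> Nphi; rewrite irr_consttE => ij_neq0.
rewrite [in leRHS](cfun_sum_cfdot phi) raddf_sum cfdot_suml (bigD1 i) //=.
have Nres (k : Iirr G) : '['Res[H] 'chi_k, 'chi_j] \in Num.nat.
  by apply/Cnat_cfdot_char_irr/cfRes_char/irr_char.
have Nmul (k : Iirr G) : '[phi, 'chi_k] \in Num.nat by rewrite Cnat_cfdot_char_irr.
apply: ler_wpDr.
  by apply: sumr_ge0 => k _; rewrite linearZ /= cfdotZl mulr_ge0 ?natr_ge0.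
rewrite linearZ /= cfdotZl ler_peMr ?natr_ge0 //.
by have /natrP[m def_m] := Nres i; rewrite def_m pnatr_eq0 ler1n lt0n in ij_neq0 *.
Qed.

Lemma cfRes_irr_of_constt (gT : finGroupType) (G N : {group gT})
    (chi : 'CF(G)) :
    N <| G -> chi \in irr G ->
    (forall i, i \in nonprincipal_constt (chi * chi^*%CF) ->
       ~~ (N \subset cfker 'chi_i)) ->
  'Res[N] chi \in irr N.
Proof.
move=> nsNG irr_chi kerS; have Nchi := irrWchar irr_chi.
rewrite irrEchar cfRes_char //= -[X in '[_, X]]mul1r -cfdot_mul_conjC.
rewrite cfAutRes -rmorphM -irr0.
rewrite (cfun_sum_cfdot (chi * chi^*%CF)) raddf_sum cfdot_suml.
rewrite (bigD1 0) //= big1 => [|i nz_i].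
  rewrite addr0 linearZ /= cfdotZl cfdot_mul_conjC !irr0 mul1r.
  have /irrP[k ->] := irr_chi.
  by rewrite cfnorm_irr cfRes_cfun1 cfnorm1 mulr1.
(* As [N] is normal, a constituent whose restriction to [N] contains the principal character has [N]
   in its kernel, which [kerS] forbids. *)
rewrite linearZ /= cfdotZl; apply/eqP; rewrite mulf_eq0 -implyNb; apply/implyP.
move=> Si; apply: contraNT (kerS i _); last by rewrite inE irr_consttE Si.
by move=> c0; apply: constt0_Res_cfker.
Qed.

Lemma solvable_abelian_over (gT : finGroupType) (G K : {group gT}) :
    solvable G -> K <| G -> K != G ->
  {L : {group gT} | L <| G & (K \proper L) && (L^`(1)%g \subset K)}.
Proof.
move=> solG nsKG neKG; have nKG := normal_norm nsKG.
have exn: exists n, G^`(n)%g \subset K.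
  have /derivedP[n derG1] := solG.
  by exists n; rewrite derG1 sub1G.
case: (ex_minnP exn) => -[|n] sDnK minn.
  by case/negP: neKG; rewrite -val_eqE eqEsubset normal_sub.
have nsDG := der_normal n G; exists (K <*> G^`(n))%G; first exact: normalY.
have nKD := subset_trans (der_sub n G) nKG.
rewrite properE joing_subl join_subG subxx /=; apply/andP; split.
  by apply/negP => /minn; rewrite ltnn.
rewrite der1_min ?join_subG ?normG //= quotientYidl //.
by rewrite sub_der1_abelian.
Qed.

(** Otherwise the kernel condition of [cfRes_irr_of_constt] is vacuous even for the trivial
    subgroup, where irreducible characters have degree 1. *)
Lemma nonprincipal_constt_neq0 (gT : finGroupType) (G : {group gT})
    (chi : 'CF(G)) :
    chi \in irr G -> 1 < chi 1%g -> nonprincipal_constt (chi * chi^*%CF) != set0.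
Proof.
move=> irr_chi; apply: contraTneq => S0.
have /irrP[i chi1]: 'Res[1%G] chi \in irr 1%G.
  by apply: cfRes_irr_of_constt (normal1 G) irr_chi _ => i; rewrite S0 inE.
have lin_i: 'chi_i \is a linear_char by apply/char_abelianP/abelian1.
by rewrite -(cfRes1 1%G) chi1 lin_char1 // ltxx.
Qed.

Lemma exists_maximal_kernel (gT : finGroupType) (G : {group gT})
    (S : {set Iirr G}) :
  S != set0 -> exists j, has_maximal_kernel S j.
Proof.
(* A kernel of maximal order is maximal under inclusion. *)
case/set0Pn=> i0 Si0; case: (arg_maxnP (fun i => #|cfker 'chi_i|) Si0) => j Sj maxj.
exists j; split=> // i Si sji; apply/eqP.
by rewrite eq_sym eqEcard sji; apply: maxj.
Qed.

Lemma maximal_kernel_mult1 (gT : finGroupType) (G : {group gT})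
    (chi : 'CF(G)) (j : Iirr G) :
    solvable G -> chi \in irr G ->
    has_maximal_kernel (nonprincipal_constt (chi * chi^*%CF)) j ->
  '[chi * chi^*%CF, 'chi_j] = 1.
Proof.
move=> solG irr_chi [Sj maxj].
have /andP[jconst nz_j]: (j \in irr_constt (chi * chi^*%CF)) && (j != 0).
  by move: Sj; rewrite inE.
have Nphi: chi * chi^*%CF \is a character.
  by rewrite rpredM ?cfConjC_char ?irrWchar.
have neKG: cfker_group 'chi_j != G.
  apply: contraNneq nz_j => /(congr1 val) /= kerG.
  by rewrite -subGcfker kerG.
have [L nsLG /andP[ltKL derLK]] :=
  solvable_abelian_over solG (cfker_normal 'chi_j) neKG.
have irr_theta: 'Res[L] chi \in irr L.
  apply: cfRes_irr_of_constt nsLG irr_chi _ => i Si.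
  apply/negP => sLi; have ltji := proper_sub_trans ltKL sLi.
  by move: (ltji); rewrite (maxj i Si (proper_sub ltji)) properE subxx.
have [k kconst] := constt_cfRes_irr L j.
have lin_k: 'chi_k \is a linear_char.
  (* The derived subgroup of [L] lies in the kernel of ['Res[L] 'chi_j], hence in that of its
     constituent ['chi_k]. *)
  rewrite lin_irr_der1 (subset_trans _ (cfker_constt _ kconst)) //.
    by rewrite sub_cfker_Res ?der_sub.
  by rewrite cfRes_char ?irr_char.
have := cfdot_mul_conjC_lin_le1 irr_theta lin_k.
rewrite cfAutRes -rmorphM => /(le_trans (cfdot_le_Res Nphi kconst)).
have /natrP[m def_m] := Cnat_cfdot_char_irr j Nphi.
move: jconst; rewrite irr_consttE def_m pnatr_eq0 lern1 -lt0n => m_gt0 m_le1.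
suff -> : m = 1%N by [].
by apply/eqP; rewrite eqn_leq m_le1.
Qed.

Theorem theoremC (gT : finGroupType) (G : {group gT}) (chi : 'CF(G))
    (solG : solvable G) (irr_chi : chi \in irr G) (chi1_gt1 : 1 < chi 1%g) :
  (forall j : Iirr G,
     has_maximal_kernel (nonprincipal_constt (chi * chi^*%CF)) j ->
     '[chi * chi^*%CF, 'chi_j] = 1)
  /\ 1 \in [seq '[chi * chi^*%CF, 'chi_i]
             | i in nonprincipal_constt (chi * chi^*%CF)].
Proof.
have mult1 j := @maximal_kernel_mult1 _ G chi j solG irr_chi.
split=> //.
have [j maxj] := exists_maximal_kernel (nonprincipal_constt_neq0 irr_chi chi1_gt1).
by apply/imageP; exists j; [case: maxj | rewrite mult1].
Qed.
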